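(* For each integer $n\geq 1$ and every $x\in\mathbb{C}$, \[ \sum_{k=1}^{\lfloor n/2 \rfloor} \binom{n-1}{2k-1} C_{2(n-2k)}(x)\,\bigl(144x^2(9x^2-1)\bigr)^{k} E_{2k-1}(0) = 12x(1-9x^2)\,B_{2n-2}^*(x). \]
   Context: Balancing polynomials $B_n^*(x)$ and Lucas-balancing polynomials $C_n(x)$ are defined by the recurrence $w_n(x)=6x\,w_{n-1}(x)-w_{n-2}(x)$ for $n\geq 2$, with $B_0^*(x)=0$, $B_1^*(x)=1$ and $C_0(x)=1$, $C_1(x)=3x$. Euler polynomials $E_n(x)$ are defined by $\sum_{n\geq 0} E_n(x)\frac{z^n}{n!}=\frac{2e^{xz}}{e^z+1}$. *)

(* Defs.v *)
From HB Require Import structures.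
From mathcomp Require Import all_boot all_order all_algebra.
From mathcomp Require Import complex.
From mathcomp Require Import reals.

Set Implicit Arguments.
Unset Strict Implicit.
Unset Printing Implicit Defensive.

Import GRing.Theory Num.Theory.
Local Open Scope ring_scope.

Fixpoint balancing_poly (F : fieldType) (n : nat) {struct n} : {poly F} :=
  match n with
  | 0 => 0
  | n1.+1 =>
    match n1 with
    | 0 => 1
    | n2.+1 => 6%:R *: 'X * balancing_poly F n1 - balancing_poly F n2
    end
  end.

Fixpoint lucas_balancing_poly (F : fieldType) (n : nat) {struct n} : {poly F} :=
  match n with
  | 0 => 1
  | n1.+1 =>
    match n1 with
    | 0 => 3%:R *: 'X
    | n2.+1 =>
      6%:R *: 'X * lucas_balancing_poly F n1 - lucas_balancing_poly F n2
    end
  end.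

(* A formal power series in z is its coefficient sequence nat -> A. *)

Definition fps_add (A : nzRingType) (f g : nat -> A) : nat -> A :=
  fun n => f n + g n.

Definition fps_mul (A : nzRingType) (f g : nat -> A) : nat -> A :=
  fun n => \sum_(i < n.+1) f i * g (n - i)%N.

Definition fps_const (A : nzRingType) (a : A) : nat -> A :=
  fun n => if n is 0 then a else 0.

(* The series e^(a z). *)
Definition fps_exp (A : unitRingType) (a : A) : nat -> A :=
  fun n => a ^+ n / n`!%:R.

(* First n coefficients of 1/f: g_n = - f_0^-1 * sum_(i < n) f_(n-i) g_i. *)
Fixpoint fps_inv_seq (A : unitRingType) (f : nat -> A) (n : nat) : seq A :=
  if n is m.+1 then
    let s := fps_inv_seq f m in
    rcons s (if m is 0 then (f 0%N)^-1
             else - (f 0%N)^-1 * \sum_(i < m) f (m - i)%N * s`_i)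
  else [::].

Definition fps_inv (A : unitRingType) (f : nat -> A) : nat -> A :=
  fun n => (fps_inv_seq f n.+1)`_n.

Lemma size_fps_inv_seq (A : unitRingType) (f : nat -> A) n :
  size (fps_inv_seq f n) = n.
Proof. by elim: n => //= n IH; rewrite size_rcons IH. Qed.

Lemma nth_fps_inv_seq (A : unitRingType) (f : nat -> A) n i :
  (i < n)%N -> (fps_inv_seq f n)`_i = fps_inv f i.
Proof.
elim: n => // n IH; rewrite ltnS leq_eqVlt => /predU1P[-> //|lt_in].
by rewrite /= nth_rcons size_fps_inv_seq lt_in IH.
Qed.

Lemma fps_invS (A : unitRingType) (f : nat -> A) n :
  fps_inv f n.+1 =
    - (f 0%N)^-1 * \sum_(i < n.+1) f (n.+1 - i)%N * fps_inv f i.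
Proof.
rewrite {1}/fps_inv.
have -> : fps_inv_seq f n.+2 = rcons (fps_inv_seq f n.+1)
  (- (f 0%N)^-1 * \sum_(i < n.+1) f (n.+1 - i)%N * (fps_inv_seq f n.+1)`_i).
  by [].
rewrite nth_rcons size_fps_inv_seq ltnn eqxx; congr (_ * _).
by apply: eq_bigr => i _; rewrite nth_fps_inv_seq.
Qed.

Lemma fps_mulVf (A : comUnitRingType) (f : nat -> A) :
  f 0%N \is a GRing.unit -> fps_mul (fps_inv f) f =1 fps_const 1.
Proof.
move=> uf [|n]; rewrite /fps_mul.
  by rewrite big_ord_recr big_ord0 /= add0r /fps_inv /= mulVr.
rewrite big_ord_recr /= subnn fps_invS mulrAC mulNr mulVr // mulN1r.
apply/eqP; rewrite subr_eq0; apply/eqP.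
by apply: eq_bigr => i _; rewrite mulrC.
Qed.

Lemma fps_mul_coef (A : nzRingType) (f g : nat -> A) (p q : {poly A}) n :
  (forall i, (i <= n)%N -> p`_i = f i) -> (forall i, (i <= n)%N -> q`_i = g i) ->
  fps_mul f g n = (p * q)`_n.
Proof.
move=> pf qg; rewrite coefM; apply: eq_bigr => i _.
by rewrite pf ?qg ?leq_subr // -ltnS.
Qed.

Lemma fps_mulA (A : nzRingType) (f g h : nat -> A) :
  fps_mul f (fps_mul g h) =1 fps_mul (fps_mul f g) h.
Proof.
move=> n; pose T (u : nat -> A) := \poly_(i < n.+1) u i.
have TE u i : (i <= n)%N -> (T u)`_i = u i by move=> lin; rewrite coef_poly ltnS lin.
have TM u v i : (i <= n)%N -> (T u * T v)`_i = fps_mul u v i.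
  move=> lin; rewrite (@fps_mul_coef _ u v (T u) (T v)) // => j lji;
    exact: TE (leq_trans lji lin).
by rewrite (fps_mul_coef (TE f) (TM g h)) (fps_mul_coef (TM f g) (TE h)) mulrA.
Qed.

(* E_n(x) is n! times the coefficient of z^n in 2 e^(x z) / (e^z + 1),
   expanded over the coefficient ring {poly F} of polynomials in x. *)
Definition euler_poly (F : numFieldType) (n : nat) : {poly F} :=
  n`!%:R *
  fps_mul (fps_mul (fps_const 2%:R) (fps_exp 'X))
          (fps_inv (fps_add (fps_exp 1) (fps_const 1))) n.

Lemma natr_poly_unit (F : numFieldType) n :
  (0 < n)%N -> (n%:R : {poly F}) \is a GRing.unit.
Proof.
move=> n0; rewrite -polyC_natr poly_unitE coefC size_polyC /=.
by rewrite unitfE pnatr_eq0 -lt0n n0.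
Qed.

Lemma euler_poly_gf (F : numFieldType) :
  fps_mul (fun n => euler_poly F n / n`!%:R) (fps_add (fps_exp 1) (fps_const 1))
  =1 fps_mul (fps_const 2%:R) (fps_exp 'X).
Proof.
set d := fps_add _ _; set e := fps_mul (fps_const _) _ => n.
have ud : d 0%N \is a GRing.unit.
  have -> : d 0%N = 2%:R by rewrite /d /fps_add /fps_exp /= fact0 divr1.
  exact: natr_poly_unit.
transitivity (fps_mul (fps_mul e (fps_inv d)) d n).
  apply: eq_bigr => i _; rewrite /euler_poly -/d -/e; congr (_ * _).
  have ui : (i`!%:R : {poly F}) \is a GRing.unit.
    by apply: natr_poly_unit; apply: fact_gt0.
  by rewrite mulrAC divrr // mul1r.
rewrite -fps_mulA [LHS]/fps_mul big_ord_recr /= big1 ?add0r.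
  by rewrite subnn fps_mulVf //= mulr1.
move=> i _; rewrite fps_mulVf //; have := ltn_ord i; rewrite -subn_gt0.
by case: (n - i)%N => //= m _; rewrite mulr0.
Qed.

(* Main.v *)
Require Import Defs.
From HB Require Import structures.
From mathcomp Require Import all_boot all_order all_algebra.
From mathcomp Require Import complex.
From mathcomp Require Import reals.
From mathcomp Require Import ring.

(** Put s^2 = 9x^2 - 1, a = (3x + s)^2, b = (3x - s)^2 and d = a - b = 12xs.
    The Binet formulas give 2 C_{2m} = a^m + b^m and 2 s B_{2m} = a^m - b^m.
    The generating function at 0 gives (E + 1)^N + E^N = 2 [N = 0] umbrally,
    hence (a + d E)^N + (b + d E)^N = 2 b^N. Subtracting the same identity with
    a and b exchanged keeps exactly the odd powers of E, and the claim follows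
    with N = n - 1. *)

Set Implicit Arguments.
Unset Strict Implicit.
Unset Printing Implicit Defensive.

Import GRing.Theory Num.Theory.
Local Open Scope ring_scope.

Lemma horner_div_natr (F : numFieldType) (p : {poly F}) (m : nat) (x : F) :
  (0 < m)%N -> (p / m%:R).[x] = p.[x] / m%:R.
Proof.
move=> m0; have um := natr_poly_unit F m0.
have m_neq0 : m%:R != 0 :> F by rewrite pnatr_eq0 -lt0n.
apply: (mulIf m_neq0); rewrite divfK //.
by rewrite -[in RHS](divrK um p) !mulr_natr hornerMn.
Qed.

(** This compares the coefficients of [z^n] in [E(z) (e^z + 1) = 2 e^(xz)] at [x = 0], scaled by
    [n!]. The isolated last term comes from the constant 1 in [e^z + 1]. *)
Lemma euler_poly0_rec (F : numFieldType) (n : nat) :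
  \sum_(i < n.+1) (euler_poly F i).[0] *+ 'C(n, i) + (euler_poly F n).[0]
  = 2%:R *+ (n == 0%N).
Proof.
have fact_neq0 m : m`!%:R != 0 :> F by rewrite pnatr_eq0 -lt0n fact_gt0.
have := congr1 (fun p => p.[0] * n`!%:R) (@euler_poly_gf F n).
rewrite /fps_mul !horner_sum !mulr_suml.
move: (euler_poly F) => E gfn.
(* The isolated term is absorbed into the sum at [i = n], the only index where [fps_const 1]
   contributes, so that both sides can be compared termwise. *)
transitivity (\sum_(i < n.+1) ((E i).[0] *+ 'C(n, i)
                + (if i == n :> nat then (E n).[0] else 0))).
  rewrite big_split /=; congr (_ + _).
  by rewrite (big_ord_recr n) /= eqxx big1 ?add0r // => i _; rewrite ltn_eqF.
transitivity (\sum_(i < n.+1) (E i / i`!%:R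
    * fps_add (fps_exp 1) (fps_const 1) (n - i)).[0] * n`!%:R).
  apply: eq_bigr => i _; have le_in : (i <= n)%N by rewrite -ltnS.
  rewrite hornerM horner_div_natr ?fact_gt0 // hornerD.
  rewrite /fps_exp expr1n horner_div_natr ?fact_gt0 // hornerC.
  rewrite mulrDr mulrDl -mulr_natr; congr (_ + _).
    rewrite -(bin_fact le_in) !natrM.
    by field; rewrite !fact_neq0.
  case: eqP => [->|/eqP ne_in].
    by rewrite subnn hornerC mulr1 divfK.
  have: (0 < n - i)%N by rewrite subn_gt0 ltn_neqAle ne_in.
  by case: (n - i)%N => // m _; rewrite /= horner0 mulr0 mul0r.
rewrite gfn big_ord_recl subn0 big1 => [|i _]; last first.
  by rewrite /= mul0r horner0 mul0r.
rewrite addr0 hornerM /fps_exp horner_div_natr ?fact_gt0 //.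
rewrite /= -polyC_natr hornerC -mulrA divfK // hornerXn expr0n.
by rewrite mulr_natr.
Qed.

Lemma coef_XD1n (F : nzRingType) (m i : nat) :
  (('X + 1 : {poly F}) ^+ m)`_i = 'C(m, i)%:R.
Proof.
rewrite exprD1n; under eq_bigr do rewrite -scaler_nat.
rewrite -(poly_def m.+1 (fun i => 'C(m, i)%:R)) coef_poly ltnS.
by case: leqP => // /bin_small ->.
Qed.

(** Let [L] be the linear functional sending ['X^j] to [e j]. The hypothesis says [L (('X + 1)^m) =
    2 [m = 0] - e m]. Expanding [(a + d ('X + 1))^N] under [L] therefore gives
    [2 a^N - L ((a + d 'X)^N)]. *)
Lemma umbral_shift (F : comNzRingType) (e : nat -> F) (a d : F) (N : nat) :
  (forall n, \sum_(i < n.+1) e i *+ 'C(n, i) + e n = 2%:R *+ (n == 0%N)) ->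
  \sum_(j < N.+1) ((a + d) ^+ (N - j) + a ^+ (N - j)) * d ^+ j * e j *+ 'C(N, j)
  = 2%:R * a ^+ N.
Proof.
(* Cutting off after degree [N] is harmless: [L] is only applied to [N]-th powers of polynomials of
   degree at most 1. *)
move=> eP; pose L (p : {poly F}) := \sum_(j < N.+1) p`_j * e j.
have LE c : L ((c%:P + d *: 'X) ^+ N) =
    \sum_(j < N.+1) c ^+ (N - j) * d ^+ j * e j *+ 'C(N, j).
  apply: eq_bigr => j _; rewrite exprDn coef_sum (bigD1 j) //= big1 => [|i ne_ij].
    rewrite coefMn -rmorphXn /= coefCM exprZn coefZ coefXn eqxx mulr1 addr0.
    by rewrite mulrnAl.
  rewrite coefMn -rmorphXn /= coefCM exprZn coefZ coefXn eq_sym.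
  by rewrite (inj_eq val_inj) (negPf ne_ij) !mulr0 mul0rn.
have Lshift : L (((a + d)%:P + d *: 'X) ^+ N) =
    \sum_(m < N.+1) a ^+ (N - m) * d ^+ m * (2%:R *+ (m == 0%N :> nat) - e m)
      *+ 'C(N, m).
  have -> : (a + d)%:P + d *: 'X = a%:P + d *: ('X + 1).
    by rewrite scalerDr polyCD alg_polyC addrAC addrA.
  rewrite exprDn /L; under eq_bigr do rewrite coef_sum mulr_suml.
  rewrite exchange_big; apply: eq_bigr => m _ /=.
  rewrite -eP addrK.
  under eq_bigr do
    rewrite coefMn -rmorphXn /= coefCM exprZn coefZ coef_XD1n mulrA mulrnAl -mulrA.
  rewrite sumrMnl -mulr_sumr; congr (_ * _ *+ _).
  have le_mN : (m.+1 <= N.+1)%N by [].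
  rewrite (big_ord_widen _ (fun i => e i *+ 'C(m, i)) le_mN) [RHS]big_mkcond /=.
  apply: eq_bigr => i _; rewrite mulr_natl ltnS.
  by case: leqP => // lt_mi; rewrite bin_small.
under eq_bigr do rewrite mulrDl mulrDl mulrnDl.
rewrite big_split /= -LE Lshift -big_split /= big_ord_recl big1 => [|i _].
  by rewrite /= subn0 expr0 bin0; ring.
by rewrite /= mulr0n sub0r mulrN mulNrn addNr.
Qed.

(** Exchanging [a] and [b] in [umbral_shift] multiplies the [j]-th term by [(-1)^j], so subtraction
    cancels the even terms and doubles the odd ones. *)
Lemma umbral_odd (F : numFieldType) (e : nat -> F) (a b : F) (N : nat) :
  (forall n, \sum_(i < n.+1) e i *+ 'C(n, i) + e n = 2%:R *+ (n == 0%N)) ->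
  \sum_(j < N.+1 | odd j)
     (a ^+ (N - j) + b ^+ (N - j)) * (a - b) ^+ j * e j *+ 'C(N, j)
  = b ^+ N - a ^+ N.
Proof.
move=> eP; have two_neq0 : 2%:R != 0 :> F by rewrite pnatr_eq0.
apply: (mulfI two_neq0).
have := umbral_shift b (a - b) N eP; rewrite subrKC => idb.
have := umbral_shift a (b - a) N eP; rewrite subrKC => ida.
rewrite mulrBr -ida -idb -sumrB mulr_sumr big_mkcond; apply: eq_bigr => j _ /=.
rewrite -(opprB a b) exprNn -signr_odd.
by case: (odd j) => /=; ring.
Qed.

(** [3x + s] is a root of [t^2 = 6x t - 1], the characteristic equation of the recurrence; replacing
    [s] by [- s] gives the other root. *)
Lemma balancing_root_exp (F : comNzRingType) (x s : F) (n : nat) :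
  s ^+ 2 = 9%:R * x ^+ 2 - 1 ->
  (3%:R * x + s) ^+ n.+2
  = 6%:R * x * (3%:R * x + s) ^+ n.+1 - (3%:R * x + s) ^+ n.
Proof.
move=> s2; have E : (3%:R * x + s) ^+ 2 = 6%:R * x * (3%:R * x + s) - 1.
  by rewrite sqrrD s2; ring.
by rewrite -(addn2 n) exprD E exprS; ring.
Qed.

Lemma lucas_balancing_binet (F : fieldType) (x s : F) (n : nat) :
  s ^+ 2 = 9%:R * x ^+ 2 - 1 ->
  2%:R * (lucas_balancing_poly F n).[x] = (3%:R * x + s) ^+ n + (3%:R * x - s) ^+ n.
Proof.
move=> s2; elim/ltn_ind: n => -[|[|n]] IH.
- by rewrite /= hornerC !expr0; ring.
- by rewrite /= hornerZ hornerX; ring.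
have -> : (lucas_balancing_poly F n.+2).[x] =
    6%:R * x * (lucas_balancing_poly F n.+1).[x] - (lucas_balancing_poly F n).[x].
  by rewrite [lucas_balancing_poly F n.+2]/= hornerD hornerN hornerM hornerZ hornerX.
rewrite mulrBr mulrCA !IH //.
by rewrite (balancing_root_exp _ s2) (@balancing_root_exp _ x (- s)) ?sqrrN //; ring.
Qed.

(** Keeping [2 s] on the left avoids a division and covers the double root [s = 0]. *)
Lemma balancing_binet (F : fieldType) (x s : F) (n : nat) :
  s ^+ 2 = 9%:R * x ^+ 2 - 1 ->
  2%:R * s * (balancing_poly F n).[x] = (3%:R * x + s) ^+ n - (3%:R * x - s) ^+ n.
Proof.
move=> s2; elim/ltn_ind: n => -[|[|n]] IH.
- by rewrite /= horner0 !expr0; ring.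
- by rewrite /= hornerC; ring.
have -> : (balancing_poly F n.+2).[x] =
    6%:R * x * (balancing_poly F n.+1).[x] - (balancing_poly F n).[x].
  by rewrite [balancing_poly F n.+2]/= hornerD hornerN hornerM hornerZ hornerX.
rewrite mulrBr mulrCA !IH //.
by rewrite (balancing_root_exp _ s2) (@balancing_root_exp _ x (- s)) ?sqrrN //; ring.
Qed.

Lemma big_odd_half (V : nmodType) (f : nat -> V) (N : nat) :
  \sum_(j < N | odd j) f j = \sum_(1 <= k < (N %/ 2).+1) f (2 * k - 1)%N.
Proof.
elim: N => [|N IH]; first by rewrite big_ord0 big_geq.
rewrite big_mkcond big_ord_recr -big_mkcond /= IH !divn2 /= uphalf_half.
case: ifP => [oN|_]; last by rewrite addr0.
(* For odd [N] the range of [k] gains [(N + 1) / 2], whose index [2k - 1] is [N] itself. *)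
rewrite [RHS]big_nat_recr //=; congr (_ + f _).
by rewrite -[LHS]odd_double_half oN mul2n doubleS subn1.
Qed.

Theorem theorem1 (R : realType) (n : nat) (hn : (1 <= n)%N) (x : R[i]) :
  \sum_(1 <= k < (n %/ 2).+1)
     'C(n - 1, 2 * k - 1)%:R
     * (lucas_balancing_poly R[i] (2 * (n - 2 * k))).[x]
     * (144%:R * x ^+ 2 * (9%:R * x ^+ 2 - 1)) ^+ k
     * (euler_poly R[i] (2 * k - 1)).[0]
  = 12%:R * x * (1 - 9%:R * x ^+ 2)
    * (balancing_poly R[i] (2 * n - 2)).[x].
Proof.
case: n hn => // N _; rewrite subSS subn0.
pose s := sqrtC (9%:R * x ^+ 2 - 1).
have s2 : s ^+ 2 = 9%:R * x ^+ 2 - 1 by rewrite sqrtCK.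
(* The roots are squared because only even indices [2 (n - 2k)] and [2n - 2] occur. *)
pose a := (3%:R * x + s) ^+ 2; pose b := (3%:R * x - s) ^+ 2.
have dE : a - b = 12%:R * x * s by rewrite /a /b; ring.
have d2 : 144%:R * x ^+ 2 * (9%:R * x ^+ 2 - 1) = (a - b) ^+ 2.
  by rewrite dE -s2; ring.
have two_neq0 : 2%:R != 0 :> R[i] by rewrite pnatr_eq0.
have := umbral_odd a b N (@euler_poly0_rec R[i]).
rewrite (big_odd_half (fun j => (a ^+ (N - j) + b ^+ (N - j)) * (a - b) ^+ j
  * (euler_poly R[i] j).[0] *+ 'C(N, j))) => oddE.
apply: (mulfI two_neq0).
(* The [k]-th term carries [(a - b)^(2k)], one factor more than the exponent [j = 2k - 1] in
   [umbral_odd]; this is the factor [a - b] in front. *)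
transitivity ((a - b) * (b ^+ N - a ^+ N)).
  rewrite -oddE !mulr_sumr; apply: eq_big_nat => -[//|k] /andP[_ _].
  have -> : (2 * k.+1 - 1 = k.*2.+1)%N by rewrite mul2n doubleS subn1.
  have -> : (N.+1 - 2 * k.+1 = N - k.*2.+1)%N by rewrite mul2n doubleS subSS.
  set m := (N - _)%N.
  have cE := lucas_balancing_binet (2 * m) s2; rewrite !exprM -/a -/b in cE.
  rewrite -cE d2 -exprM (mul2n k.+1) doubleS exprS.
  ring.
have -> : (2 * N.+1 - 2 = 2 * N)%N by rewrite mulnS addKn.
have bE := balancing_binet (2 * N) s2; rewrite !exprM -/a -/b in bE.
have -> : b ^+ N - a ^+ N = - (2%:R * s * (balancing_poly R[i] (2 * N)).[x]).
  by rewrite bE opprB.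
have -> : 1 - 9%:R * x ^+ 2 = - s ^+ 2 by rewrite s2 opprB.
by rewrite dE; ring.
Qed.
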